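(* Let $P\in\mathcal{W}(\mathcal{X},\mathcal{D})$, and let $\mathcal{C}\subset\mathcal{W}(\mathcal{X},\mathcal{D}')$, with $\mathcal{D}\subset\mathcal{D}'$, be non-empty, closed and e-convex. Then the reverse information projection $rI^{(\mathcal{C})}P=\arg\min_{\bar P\in\mathcal{C}}D(P\|\bar P)$ exists, in the sense that the minimum is attained for a unique element in $\mathcal{C}$. Let $P_0\in\mathcal{C}$; the following two statements are equivalent: (i) for any $\bar P\in\mathcal{C}$, $D(P\|\bar P)\ge D(P\|P_0)+D(P_0\|\bar P)$; (ii) $P_0=rI^{(\mathcal{C})}P$.
   Context: $\mathcal{X}$ is a finite set with at least two elements, and $(\mathcal{X},\mathcal{D})$, $(\mathcal{X},\mathcal{D}')$ are strongly connected directed graphs with edge sets $\mathcal{D},\mathcal{D}'\subset\mathcal{X}^2$. $\mathcal{W}(\mathcal{X},\mathcal{D})$ is the set of row-stochastic matrices on $\mathcal{X}$ that are strictly positive on $\mathcal{D}$ and zero outside $\mathcal{D}$ (these are irreducible), regarded as a smooth manifold of dimension $|\mathcal{D}|-|\mathcal{X}|$; similarly for $\mathcal{D}'$. For $P\in\mathcal{W}(\mathcal{X},\mathcal{D})$ with unique stationary distribution $\pi$ and $\bar P\in\mathcal{W}(\mathcal{X},\mathcal{D}')$, the information divergence is $D(P\|\bar P)=\sum_{(x,x')\in\mathcal{D}}\pi(x)P(x,x')\log\frac{P(x,x')}{\bar P(x,x')}$; for $P_0,\bar P\in\mathcal{W}(\mathcal{X},\mathcal{D}')$, $D(P_0\|\bar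 P)$ is defined likewise with the sum over $\mathcal{D}'$ and the stationary distribution of $P_0$. For a nonnegative irreducible matrix $A$ supported exactly on $\mathcal{D}'$, with Perron–Frobenius root $\rho_A$ and positive right Perron–Frobenius eigenvector $v_A$, put $\mathfrak{s}(A)(x,x')=\frac{A(x,x')v_A(x')}{\rho_A v_A(x)}$, so that $\mathfrak{s}(A)\in\mathcal{W}(\mathcal{X},\mathcal{D}')$. For $P_0,P_1\in\mathcal{W}(\mathcal{X},\mathcal{D}')$ the e-geodesic through them is $\gamma^{(e)}_{P_0,P_1}(t)=\mathfrak{s}(A_t)$, $t\in\mathbb{R}$, where $A_t(x,x')=P_0(x,x')^{1-t}P_1(x,x')^{t}$ on $\mathcal{D}'$ and $0$ elsewhere. A submanifold $\mathcal{C}$ of $\mathcal{W}(\mathcal{X},\mathcal{D}')$ is called e-convex when $\gamma^{(e)}_{P_0,P_1}(t)\in\mathcal{C}$ for all $P_0,P_1\in\mathcal{C}$ and all $t\in[0,1]$.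
   Formalization: ''Closed'' is taken as closed in the set of stochastic matrices with support between D and D' (this is W(X,D') if D=D'; implied by closedness among all matrices). With closedness in W(X,D') only and D a proper subset of D', existence fails, e.g. for C=W(X,D'). *)

(* Defs.v *)
From HB Require Import structures.
From mathcomp Require Import all_boot all_order all_algebra.
From mathcomp Require Import complex.
From mathcomp Require Import all_classical all_reals all_analysis.

Set Implicit Arguments.
Unset Strict Implicit.
Unset Printing Implicit Defensive.

Import Order.TTheory GRing.Theory Num.Theory.
Import numFieldNormedType.Exports.

Local Open Scope classical_set_scope.
Local Open Scope ring_scope.

(* The state space is 'I_n; an edge set is a {set 'I_n * 'I_n}. *)

Definition strongly_connected (n : nat) (D : {set 'I_n * 'I_n}) : Prop :=
  forall x y : 'I_n, connect (fun a b => (a, b) \in D) x y.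

Definition kernels (R : realType) (n : nat) (D : {set 'I_n * 'I_n}) :
    set 'M[R]_n :=
  [set P | (forall x, \sum_y P x y = 1) /\
           (forall x y, (x, y) \in D -> 0 < P x y) /\
           (forall x y, (x, y) \notin D -> P x y = 0)].

Definition is_stationary (R : realType) (n : nat) (P : 'M[R]_n)
    (p : 'rV[R]_n) : Prop :=
  (forall x, 0 <= p 0 x) /\ \sum_x p 0 x = 1 /\ p *m P = p.

(* Definite descriptions are rendered by xget, which returns an arbitrary
   element of the given set, and 0 if the set is empty. *)
Definition stationary (R : realType) (n : nat) (P : 'M[R]_n) : 'rV[R]_n :=
  xget 0 [set p : 'rV[R]_n | is_stationary P p].

Definition divergence (R : realType) (n : nat) (D : {set 'I_n * 'I_n})
    (P Pbar : 'M[R]_n) : R :=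
  \sum_(e in D)
    stationary P 0 e.1 * P e.1 e.2 * ln (P e.1 e.2 / Pbar e.1 e.2).

(* The eigenvalue that equals the spectral radius; the bound ranges over the
   complex spectrum of the real matrix A. *)
Definition is_perron_root (R : realType) (n : nat) (A : 'M[R]_n) (rho : R) :
    Prop :=
  eigenvalue A rho /\
  forall z : R[i], eigenvalue (map_mx (real_complex R) A) z ->
    `|z| <= real_complex R rho.

Definition perron_root (R : realType) (n : nat) (A : 'M[R]_n) : R :=
  xget 0 [set rho | is_perron_root A rho].

(* Unique only up to a positive factor, which cancels in [stoch_rescale]. *)
Definition perron_vector (R : realType) (n : nat) (A : 'M[R]_n) : 'cV[R]_n :=
  xget 0 [set v : 'cV[R]_n | (forall x, 0 < v x 0) /\ A *m v = perron_root A *: v].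

Definition stoch_rescale (R : realType) (n : nat) (A : 'M[R]_n) : 'M[R]_n :=
  \matrix_(x, y) (A x y * perron_vector A y 0 /
                  (perron_root A * perron_vector A x 0)).

Definition e_geodesic (R : realType) (n : nat) (D : {set 'I_n * 'I_n})
    (P0 P1 : 'M[R]_n) (t : R) : 'M[R]_n :=
  stoch_rescale (\matrix_(x, y)
    (if (x, y) \in D then P0 x y `^ (1 - t) * P1 x y `^ t else 0)).

Definition e_convex (R : realType) (n : nat) (D : {set 'I_n * 'I_n})
    (C : set 'M[R]_n) : Prop :=
  forall P0 P1, C P0 -> C P1 ->
  forall t : R, 0 <= t <= 1 -> C (e_geodesic D P0 P1 t).

(* The space in which closedness of C `<=` kernels D' is understood when
   projecting P in kernels D onto C: the kernels on D' with respect to which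
   the divergence from P is finite. It is kernels D' itself when D = D'
   ([kernels_between_diag]), and every set that is closed in the space of all
   matrices is closed in it ([closed_kernels_between]). When D is a proper
   subset of D', closedness relative to kernels D' alone is too weak for a
   minimizer to exist: for C = kernels D' the infimum of divergence D P is 0,
   approached by (1 - 1/k) P + (1/k) Q with Q in C, and it is not attained. *)
Definition kernels_between (R : realType) (n : nat)
    (D D' : {set 'I_n * 'I_n}) : set 'M[R]_n :=
  [set P | exists E : {set 'I_n * 'I_n},
     [/\ D \subset E, E \subset D' & kernels E P]].

Lemma kernels_between_diag (R : realType) (n : nat) (D : {set 'I_n * 'I_n}) :
  @kernels_between R n D D = kernels D.
Proof.
apply/seteqP; split=> P /= [].
  by move=> E [DE ED KE]; have <- : E = D by apply/eqP; rewrite finset.eqEsubset ED.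
by move=> h1 h2; exists D; split.
Qed.

Lemma closed_kernels_between (R : realType) (n : nat)
    (D D' : {set 'I_n * 'I_n}) (C : set 'M[R]_n) :
  closed C -> closed (C : set (subspace (kernels_between D D'))).
Proof. exact: closed_subspaceW. Qed.

Definition argmin_divergence (R : realType) (n : nat) (D : {set 'I_n * 'I_n})
    (C : set 'M[R]_n) (P : 'M[R]_n) : set 'M[R]_n :=
  [set Q | C Q /\ forall Pbar, C Pbar -> divergence D P Q <= divergence D P Pbar].

Definition reverse_projection (R : realType) (n : nat)
    (D : {set 'I_n * 'I_n}) (C : set 'M[R]_n) (P : 'M[R]_n) : 'M[R]_n :=
  xget 0 (argmin_divergence D C P).

(* Main.v *)
(* Along the e-geodesic from P0 to Pbar the divergence from P is
   (1 - t) D(P||P0) + t D(P||Pbar) + ln rho_t, where rho_t is the Perron root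
   of the geometric mixture. If P0 is a minimizer, then
   D(P||Pbar) - D(P||P0) >= - ln rho_t / t for small t > 0, and
   ln rho_t <= - t D(P0||Pbar) + O(t^2) gives the Pythagorean inequality (i).
   Applied to two minimizers, (i) and Gibbs' inequality give uniqueness.
   Existence is compactness of the sublevel sets of D(P||.) on C. *)

Require Import Defs.
From HB Require Import structures.
From mathcomp Require Import all_boot all_order all_algebra.
From mathcomp Require Import complex.
From mathcomp Require Import all_classical all_reals all_analysis.
From mathcomp Require Import ring lra.

Set Implicit Arguments.
Unset Strict Implicit.
Unset Printing Implicit Defensive.

Import Order.TTheory GRing.Theory Num.Theory.
Import numFieldNormedType.Exports.

Local Open Scope classical_set_scope.
Local Open Scope ring_scope.

(** * Compactness and continuity in spaces of matrices *)

Lemma continuous_vec_mx (R : realType) m n :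
  continuous (vec_mx : 'rV[R]_(m * n) -> 'M[R]_(m, n)).
Proof.
move=> v s /= /nbhs_ballP [e e0 es]; apply/nbhs_ballP; exists e => //= w [_ vw].
by apply: es; split=> // i j; rewrite !mxE; exact: vw.
Qed.

(** Boxes of row vectors are compact, and [vec_mx] carries this over to matrices. *)
Lemma compact_unit_cube (R : realType) m n :
  compact [set M : 'M[R]_(m, n) | forall i j, 0 <= M i j <= 1].
Proof.
set K := (X in compact X).
have -> : K = vec_mx @`
    [set v : 'rV[R]_(m * n) | forall k, `[0, 1]%classic (v ord0 k)].
  apply/seteqP; split=> [M KM /=|_ [v Kv <-] i j].
    exists (mxvec M); last exact: mxvecK.
    by case/mxvec_indexP=> i j; rewrite mxvecE /= in_itv; exact: KM.
  by rewrite mxE; have := Kv (mxvec_index i j); rewrite /= in_itv.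
apply: continuous_compact; last first.
  by apply: (@rV_compact R _ (fun=> `[0, 1]%classic)) => _; exact: segment_compact.
by apply: continuous_subspaceT; exact: continuous_vec_mx.
Qed.

Lemma closed_le_continuous (R : realType) (T : topologicalType) (f g : T -> R) :
  continuous f -> continuous g -> closed [set x | f x <= g x].
Proof.
move=> cf cg.
rewrite (_ : mkset _ = (fun x => g x - f x) @^-1` [set y | 0 <= y]); last first.
  by apply/seteqP; split=> x /=; rewrite subr_ge0.
apply: preimage_closed; last exact: closed_ge.
by move=> x _; apply: cvgB; [exact: cg | exact: cf].
Qed.

Lemma cvg_sumr (R : realType) (T : Type) (F : set_system T) (I : Type)
    (r : seq I) (Q : pred I) (f : I -> T -> R) (a : I -> R) : Filter F ->
  (forall i, Q i -> f i x @[x --> F] --> a i) ->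
  \sum_(i <- r | Q i) f i x @[x --> F] --> \sum_(i <- r | Q i) a i.
Proof. by move=> FF; apply: cvg_big => p; exact: add_continuous. Qed.

Lemma continuous_sumr (R : realType) (T : topologicalType) (I : Type)
    (r : seq I) (Q : pred I) (f : I -> T -> R) :
  (forall i, Q i -> continuous (f i)) ->
  continuous (fun x => \sum_(i <- r | Q i) f i x).
Proof. by move=> cf x; apply: cvg_sumr => i Qi; exact: cf. Qed.

(** * Perron-Frobenius theory on strongly connected graphs *)

(* The bound is on all left eigenvalues, over any numeric field containing the
   entries: this serves both for the complex spectrum and for Collatz-Wielandt
   estimates of the Perron root. *)
Lemma eigenvalue_norm_le (F : numFieldType) n (A : 'M[F]_n) (u : 'I_n -> F)
    (c z : F) :
  (forall i j, 0 <= A i j) -> (forall i, 0 < u i) ->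
  (forall i, \sum_j A i j * u j <= c * u i) ->
  eigenvalue A z -> `|z| <= c.
Proof.
move=> A0 u0 Au /eigenvalueP[w wA w0].
have [k wk] : exists k, w 0 k != 0.
  apply/existsP; apply: contraNT w0; rewrite negb_exists => /forallP w0.
  by apply/eqP/rowP=> k; rewrite mxE; apply/eqP; have := w0 k; rewrite negbK.
(* With S this weighted l1 norm of the left eigenvector, the triangle inequality and the bound on
   [A] applied to [u] give [|z| S <= c S]. *)
have S0 : 0 < \sum_j `|w 0 j| * u j.
  rewrite (bigD1 k) //= ltr_pwDl //; first by rewrite mulr_gt0 ?normr_gt0.
  by apply: sumr_ge0 => j _; rewrite mulr_ge0 // ltW.
rewrite -(ler_pM2r S0) mulr_sumr mulr_sumr.
apply: (@le_trans _ _ (\sum_j (\sum_i `|w 0 i| * A i j) * u j)).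
  apply: ler_sum => j _; rewrite mulrA ler_pM2r // -normrM.
  have -> : z * w 0 j = \sum_i w 0 i * A i j.
    by have := congr1 (fun M : 'rV_n => M 0 j) wA; rewrite !mxE.
  apply: le_trans (ler_norm_sum _ _ _) _; apply: ler_sum => i _.
  by rewrite normrM (ger0_norm (A0 _ _)).
under eq_bigr do rewrite mulr_suml; rewrite exchange_big /=.
apply: ler_sum => i _; under eq_bigr do rewrite -mulrA.
by rewrite -mulr_sumr mulrCA ler_wpM2l.
Qed.

(** The iterate is [(1 + A) ^ n] applied to [x]. Each vertex reaches some j with [x j 0 > 0] along a
    path of at most n edges, and every edge carries positivity one vertex back. *)
Lemma positive_reach (R : realType) n (D : {set 'I_n * 'I_n}) (A : 'M[R]_n)
    (F := fun x : 'cV[R]_n => x + A *m x) :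
  strongly_connected D -> (forall i j, 0 <= A i j) ->
  (forall i j, (i, j) \in D -> 0 < A i j) ->
  forall x : 'cV[R]_n, (forall i, 0 <= x i 0) -> x != 0 ->
  forall i, 0 < iter n F x i 0.
Proof.
move=> sD A0 AD x x0 xN0.
have Fle (y : 'cV[R]_n) i : (forall j, 0 <= y j 0) -> y i 0 <= F y i 0.
  move=> y0; rewrite /F [leRHS]mxE lerDl mxE.
  by apply: sumr_ge0 => j _; exact: mulr_ge0.
have It0 k : forall i, 0 <= iter k F x i 0.
  elim: k => [|k IH] i /=; first exact: x0.
  by apply: le_trans (Fle _ _ IH); exact: IH.
have [j xj] : exists j, 0 < x j 0.
  apply/existsP; apply: contraNT xN0; rewrite negb_exists => /forallP xN.
  apply/eqP/colP=> j; rewrite mxE; apply/eqP; rewrite eq_le x0 andbT leNgt.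
  exact: xN.
have Path p : forall i, path (fun a b => (a, b) \in D) i p -> last i p = j ->
    0 < iter (size p) F x i 0.
  elim: p => [|k p IH] i /=; first by move=> _ ->.
  move=> /andP[ik pk] lk; rewrite /F mxE ltr_wpDl // mxE.
  rewrite (bigD1 k) //= ltr_pwDl //; first by rewrite mulr_gt0 ?AD ?IH.
  by apply: sumr_ge0 => l _; exact: mulr_ge0.
move=> i; have /connectP[p0 pp0 lp0] := sD i j.
case: (shortenP pp0) lp0 => p pp up _ lp.
have : (size p <= n)%N.
  by have := max_card (mem (i :: p)); rewrite card_ord (card_uniqP up) => /ltnW.
(* [F] never decreases an entry of a nonnegative vector, so the iterations beyond the path length
   preserve positivity. *)
have Mono k : 0 < iter (k + size p) F x i 0.
  elim: k => [|k IH]; first by rewrite add0n Path.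
  by rewrite addSn; apply: lt_le_trans IH (Fle _ _ (It0 _)).
by move=> np; have := Mono (n - size p)%N; rewrite subnK.
Qed.

(** Collatz-Wielandt: maximize [lam] subject to [lam x <= A x] on the simplex. If equality failed at
    a maximizer, applying [(1 + A) ^ n] would make every inequality strict and [lam] could be
    increased. *)
Lemma perron_frobenius (R : realType) n (D : {set 'I_n * 'I_n}) (A : 'M[R]_n) :
  (0 < n)%N -> strongly_connected D -> (forall i j, 0 <= A i j) ->
  (forall i j, (i, j) \in D -> 0 < A i j) ->
  exists lam (v : 'cV[R]_n), (forall i, 0 < v i 0) /\ A *m v = lam *: v.
Proof.
move=> n0 sD A0 AD.
pose M := \sum_i \sum_j A i j.
pose simplex := [set x : 'cV[R]_n | (forall i, 0 <= x i 0) /\ \sum_i x i 0 = 1].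
pose K := [set p : R * 'cV[R]_n | simplex p.2 /\
   forall i, p.1 * p.2 i 0 <= \sum_j A i j * p.2 j 0].
have le1 x : simplex x -> forall i, x i 0 <= 1.
  move=> [x0 x1] i; rewrite -x1 (bigD1 i) //= lerDl; exact: sumr_ge0.
have M0 : 0 <= M by apply: sumr_ge0 => i _; exact: sumr_ge0.
have KM p : K p -> p.1 <= M.
  move=> [px Kp]; have [x0 x1] := px.
  rewrite -[p.1]mulr1 -x1 mulr_sumr.
  apply: ler_sum => i _; apply: le_trans (Kp i) _; apply: ler_sum => j _.
  by rewrite ler_piMr // le1.
(* [M] bounds the first component above; the bound below by 0 makes the feasible set compact. *)
pose K0 := [set p : R * 'cV[R]_n | K p /\ 0 <= p.1].
have cx i : continuous (fun p : R * 'cV[R]_n => p.2 i 0).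
  move=> p; apply: (@continuous_comp _ _ _ snd (fun x : 'cV[R]_n => x i 0)).
    exact: cvg_snd.
  exact: coord_continuous.
have cl : continuous (fun p : R * 'cV[R]_n => p.1) by move=> p; exact: cvg_fst.
have cK0 : compact K0.
  apply: (@subclosed_compact _ _
    (`[0, M]%classic `*` [set x : 'cV[R]_n | forall i j, 0 <= x i j <= 1])).
  - rewrite (_ : K0 = [set p | 0 <= p.1] `&`
      ((\bigcap_i [set p : R * 'cV[R]_n | 0 <= p.2 i 0]) `&`
      ([set p : R * 'cV[R]_n | \sum_i p.2 i 0 <= 1] `&`
       [set p : R * 'cV[R]_n | 1 <= \sum_i p.2 i 0] `&`
      \bigcap_i [set p : R * 'cV[R]_n |
        p.1 * p.2 i 0 <= \sum_j A i j * p.2 j 0]))); last first.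
      apply/seteqP; split=> p /=.
        move=> [[[x0 x1] xA] l0]; split=> //; split; first by move=> i _; exact: x0.
        split; first by rewrite /= x1.
        by move=> i _; exact: xA.
      move=> [l0 [x0 [[x1 x1'] xA]]]; split=> //; split; first split.
      - by move=> i; exact: x0.
      - by apply: le_anti; rewrite x1.
      - by move=> i; exact: xA.
    have cS : continuous (fun p : R * 'cV[R]_n => \sum_i p.2 i 0).
      exact: continuous_sumr.
    have cc (c : R) : continuous (fun p : R * 'cV[R]_n => c).
      by move=> p; exact: cvg_cst.
    apply: closedI; first exact: closed_le_continuous.
    apply: closedI; first by apply: closed_bigI => i _; exact: closed_le_continuous.
    apply: closedI; first by apply: closedI; exact: closed_le_continuous.
    apply: closed_bigI => i _; apply: closed_le_continuous.
      by move=> p; apply: cvgM; [exact: cl | exact: cx].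
    apply: continuous_sumr => j _ p; apply: cvgM; [exact: cvg_cst | exact: cx].
  - by apply: compact_setX; [exact: segment_compact | exact: compact_unit_cube].
  - move=> p [Kp l0]; split; first by rewrite /= in_itv /= l0 KM.
    by move=> i j; rewrite /= ord1; case: Kp => -[x0 x1] _; rewrite x0 le1.
have K0n : K0 !=set0.
  exists (0, const_mx n%:R^-1); split=> //=; split=> /=.
    split; first by move=> i; rewrite mxE invr_ge0.
    under eq_bigr do rewrite mxE.
    by rewrite sumr_const card_ord -(mulr_natl n%:R^-1) mulfV // pnatr_eq0 -lt0n.
  move=> i; rewrite mul0r; apply: sumr_ge0 => j _; rewrite mxE.
  by rewrite mulr_ge0 ?invr_ge0.
have [[lam x] /set_mem[[Kx1 Kx2] lam0] Kmax] := compact_EVT_max K0n cK0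
  (continuous_subspaceT cl).
rewrite /= in Kx1 Kx2 lam0 Kmax; have [x0 x1] := Kx1.
pose F (x : 'cV[R]_n) := x + A *m x.
have xN0 : x != 0.
  apply: contra_eq_neq x1 => ->; rewrite big1 1?eq_sym ?oner_eq0 // => i _.
  by rewrite mxE.
pose B := iter n F.
have FB k (y : 'cV[R]_n) : iter k F (A *m y - lam *: y) =
    A *m iter k F y - lam *: iter k F y.
  elim: k => //= k ->; rewrite /F mulmxBr mulmxDr scalerDr -scalemxAr.
  by rewrite opprD addrACA.
have Bx0 : forall i, 0 < B x i 0 by exact: positive_reach sD A0 AD x x0 xN0.
exists lam.
have [e|zN0] := eqVneq (A *m x - lam *: x) 0.
  have Be : A *m B x = lam *: B x.
    apply/eqP; rewrite -subr_eq0 -FB // e; apply/eqP.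
    have F0 k : iter k F 0 = 0 by elim: k => //= k ->; rewrite /F mulmx0 addr0.
    exact: F0.
  by exists (B x).
have z0 i : 0 <= (A *m x - lam *: x) i 0.
  by rewrite !mxE subr_ge0; exact: Kx2.
have Bz i := positive_reach sD A0 AD z0 zN0 i.
pose y := B x.
have S0 : 0 < \sum_i y i 0.
  rewrite (bigD1 (Ordinal n0)) //= ltr_pwDl //.
  by apply: sumr_ge0 => i _; exact: ltW.
(* The least relative slack of [y], capped at 1. Once [y] is normalized into the simplex, it is
   feasible with the larger value [lam + e]. *)
pose e := \big[Num.min/1]_i ((A *m y - lam *: y) i 0 / y i 0).
have e0 : 0 < e.
  apply: lt_bigmin => // i _; rewrite divr_gt0 // -FB; exact: Bz.
have [s s0 sE] : exists2 s, 0 < s & s * (\sum_i y i 0) = 1.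
  by exists (\sum_i y i 0)^-1; rewrite ?invr_gt0 // mulVf // gt_eqF.
have /= := Kmax (lam + e, s *: y).
rewrite gerDl leNgt e0 => /(_ _)/notF; case; apply/mem_set; split=> /=; last first.
  by rewrite addr_ge0 // ltW.
split=> /=.
  split; first by move=> i; rewrite mxE mulr_ge0 ?ltW.
  by under eq_bigr do rewrite mxE; rewrite -mulr_sumr.
move=> i; under eq_bigr do rewrite mxE mulrCA.
rewrite -mulr_sumr mxE mulrCA ler_pM2l // mulrDl -lerBrDl.
have : e <= (A *m y - lam *: y) i 0 / y i 0 by exact: bigmin_le_cond.
by rewrite ler_pdivlMr // !mxE.
Qed.

(** [eigenvalue] speaks of left eigenvectors; a square matrix with a nonzero right kernel is
    singular, hence has a nonzero left kernel. *)
Lemma eigenvalue_right (F : fieldType) n (A : 'M[F]_n) (lam : F) (v : 'cV[F]_n) :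
  v != 0 -> A *m v = lam *: v -> eigenvalue A lam.
Proof.
move=> v0 Av; rewrite /eigenvalue /eigenspace kermx_eq0 row_free_unit.
apply: contra v0 => U; rewrite -(mulKmx U v).
by rewrite mulmxBl mul_scalar_mx Av subrr mulmx0.
Qed.

Lemma positive_neq0 (R : numDomainType) n (v : 'cV[R]_n) :
  (0 < n)%N -> (forall i, 0 < v i 0) -> v != 0.
Proof.
move=> n0 v0; apply/eqP => e; have := v0 (Ordinal n0).
by rewrite e mxE ltxx.
Qed.

(** With [v] as test vector, [eigenvalue_norm_le] bounds the real and the complex spectrum by [lam],
    which is itself an eigenvalue. *)
Lemma perron_root_eq (R : realType) n (A : 'M[R]_n) (lam : R) (v : 'cV[R]_n) :
  (0 < n)%N -> (forall i j, 0 <= A i j) -> (forall i, 0 < v i 0) ->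
  A *m v = lam *: v -> perron_root A = lam.
Proof.
move=> n0 A0 v0 Av; have vN0 := positive_neq0 n0 v0.
have Avi i : \sum_j A i j * v j 0 = lam * v i 0.
  by have := congr1 (fun M : 'cV_n => M i 0) Av; rewrite !mxE.
have Elam := eigenvalue_right vN0 Av.
have bound z : eigenvalue A z -> `|z| <= lam.
  by apply: (eigenvalue_norm_le A0 v0) => i; rewrite Avi.
have lam0 : 0 <= lam := le_trans (normr_ge0 _) (bound _ Elam).
have PR : is_perron_root A lam.
  split=> // z; apply: (@eigenvalue_norm_le _ _ _ (fun i => real_complex R (v i 0))).
  - by move=> i j; rewrite mxE ler0c.
  - by move=> i; rewrite ltcR.
  - move=> i; rewrite -rmorphM -Avi rmorph_sum /=.
    by under eq_bigr do rewrite mxE -rmorphM.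
rewrite /perron_root; apply: xget_unique => // rho [Erho rhoM].
apply: le_anti; rewrite (le_trans (ler_norm _) (bound _ Erho)) /=.
have := rhoM (real_complex R lam); rewrite eigenvalue_map => /(_ Elam).
by rewrite ger0_norm ?ler0c // lecR.
Qed.

(** An outgoing edge makes the root positive; connectivity alone allows a single vertex without a
    loop, where the root may be 0. *)
Lemma perron_spec (R : realType) n (D : {set 'I_n * 'I_n}) (A : 'M[R]_n) :
  (0 < n)%N -> strongly_connected D -> (forall i, exists j, (i, j) \in D) ->
  (forall i j, 0 <= A i j) -> (forall i j, (i, j) \in D -> 0 < A i j) ->
  [/\ forall i, 0 < perron_vector A i 0, 0 < perron_root A
    & A *m perron_vector A = perron_root A *: perron_vector A].
Proof.
move=> n0 sD oD A0 AD.
have [lam [v [v0 Av]]] := perron_frobenius n0 sD A0 AD.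
have rE := perron_root_eq n0 A0 v0 Av.
have [w0 Aw] : [set v : 'cV[R]_n | (forall x, 0 < v x 0) /\
    A *m v = perron_root A *: v] (perron_vector A).
  by apply: xgetPex; exists v; rewrite /= rE.
split=> //; have i := Ordinal n0; have [j ij] := oD i.
rewrite -(pmulr_lgt0 _ (w0 i)).
have := congr1 (fun M : 'cV_n => M i 0) Aw; rewrite !mxE => <-.
rewrite (bigD1 j) //= ltr_pwDl //; first by rewrite mulr_gt0 ?AD.
by apply: sumr_ge0 => k _; rewrite mulr_ge0 // ltW.
Qed.

(** * Stationary distributions of irreducible kernels *)

Section Stationary.
Variables (R : realType) (n : nat) (D : {set 'I_n * 'I_n}) (P : 'M[R]_n).
Hypotheses (n0 : (0 < n)%N) (sD : strongly_connected D) (KP : kernels D P).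

Lemma kernel_ge0 x y : 0 <= P x y.
Proof.
case: KP => _ [pos zero]; have [/pos/ltW //|/zero ->] := boolP ((x, y) \in D).
exact: lexx.
Qed.

Lemma kernel_gt0 x y : (x, y) \in D -> 0 < P x y.
Proof. by case: KP => _ [pos _]; exact: pos. Qed.

Lemma kernel_off x y : (x, y) \notin D -> P x y = 0.
Proof. by case: KP => _ [_ off]; exact: off. Qed.

Lemma kernel_sum1 x : \sum_y P x y = 1.
Proof. by case: KP => + _; exact. Qed.

Lemma kernel_out x : exists y, (x, y) \in D.
Proof.
apply/existsP; apply: contraT; rewrite negb_exists => /forallP xD.
have := kernel_sum1 x; rewrite big1 => [/eqP|y _]; last exact: kernel_off.
by rewrite eq_sym oner_eq0.
Qed.

(** Left eigenvectors of [P] are right eigenvectors of [P^T], whose support is the reversed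
    graph. *)
Let D_rev := [set e : 'I_n * 'I_n | (e.2, e.1) \in D]%SET.

Let sD_rev : strongly_connected D_rev.
Proof.
move=> x y; rewrite -(@eq_connect _ [rel a b | (b, a) \in D]) => [|a b]; last first.
  by rewrite inE.
by rewrite (connect_rev (fun a b => (a, b) \in D)); exact: sD.
Qed.

Let PT_ge0 i j : 0 <= P^T i j.
Proof. by rewrite mxE kernel_ge0. Qed.

Let PT_gt0 i j : (i, j) \in D_rev -> 0 < P^T i j.
Proof. by rewrite mxE inE; exact: kernel_gt0. Qed.

(** [1 + P^T] doubles [u^T], so its iterates keep the zero at [k]; for nonzero [u] this contradicts
    [positive_reach]. *)
Lemma invariant_eq0 (u : 'rV[R]_n) k :
  u *m P = u -> (forall i, 0 <= u 0 i) -> u 0 k = 0 -> u = 0.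
Proof.
move=> uP u0 uk; apply: contra_eq (uk) => uN0.
have uT0 i : 0 <= u^T i 0 by rewrite mxE.
have uTN0 : u^T != 0 by rewrite -trmx0 (inj_eq trmx_inj).
have := positive_reach sD_rev PT_ge0 PT_gt0 uT0 uTN0 k.
have it m : iter m (fun x : 'cV[R]_n => x + P^T *m x) u^T = 2 ^+ m *: u^T.
  elim: m => [|m IH]; first by rewrite scale1r.
  rewrite iterS IH -scalemxAr -trmx_mul uP -scalerDr exprSr -scalerA.
  by rewrite scaler_nat mulr2n.
by rewrite it !mxE uk mulr0 ltxx.
Qed.

(** The normalized Perron vector of [P^T] is the candidate. Since [P] preserves total mass, its
    eigenvalue is 1. *)
Lemma stationary_spec :
  [/\ forall x, 0 < stationary P 0 x, \sum_x stationary P 0 x = 1,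
      stationary P *m P = stationary P
    & forall u : 'rV[R]_n, u *m P = u -> exists c, u = c *: stationary P].
Proof.
have [lam [v [v0 Pv]]] := perron_frobenius n0 sD_rev PT_ge0 PT_gt0.
have i0 := Ordinal n0.
pose S := \sum_x v x 0.
have S0 : 0 < S.
  by rewrite /S (bigD1 i0) //= ltr_pwDl // sumr_ge0 // => i _; exact: ltW.
pose p : 'rV[R]_n := S^-1 *: v^T.
have p0 x : 0 < p 0 x by rewrite !mxE mulr_gt0 ?invr_gt0.
have p1 : \sum_x p 0 x = 1.
  by under eq_bigr do rewrite !mxE; rewrite -mulr_sumr mulVf // gt_eqF.
have pPl : p *m P = lam *: p.
  by rewrite /p -scalemxAl -[P]trmxK -trmx_mul Pv linearZ /= scalerA mulrC -scalerA.
have sumP (u : 'rV[R]_n) : \sum_y (u *m P) 0 y = \sum_x u 0 x.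
  under eq_bigr do rewrite mxE; rewrite exchange_big /=; apply: eq_bigr => x _.
  by rewrite -mulr_sumr kernel_sum1 mulr1.
have lam1 : lam = 1.
  have := sumP p; rewrite pPl p1 => <-.
  by under [RHS]eq_bigr do rewrite mxE; rewrite -mulr_sumr p1 mulr1.
have pP : p *m P = p by rewrite pPl lam1 scale1r.
clearbody p.
have uniq (u : 'rV[R]_n) : u *m P = u -> exists c, u = c *: p.
  move=> uP.
  (* Subtracting the multiple of [p] given by the minimal ratio leaves a nonnegative invariant
     vector with a zero at [k]. *)
  have [k _ kmin] := @Order.TotalTheory.arg_minP _ _ _ i0 xpredT
    (fun i => u 0 i / p 0 i) isT.
  exists (u 0 k / p 0 k); apply/eqP; rewrite -subr_eq0; apply/eqP.
  apply: (@invariant_eq0 _ k).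
  - by rewrite mulmxBl uP -scalemxAl pP.
  - by move=> i; rewrite !mxE subr_ge0 -ler_pdivlMr //; exact: kmin.
  - rewrite !mxE divfK ?subrr //; exact: lt0r_neq0.
suff -> : stationary P = p by [].
apply: xget_unique.
  by split=> [x|]; [exact: ltW | split].
move=> q [q0 [q1 /uniq[c qE]]]; rewrite qE.
suff -> : c = 1 by rewrite scale1r.
rewrite -q1 qE; under eq_bigr do rewrite mxE.
by rewrite -mulr_sumr p1 mulr1.
Qed.

End Stationary.

(** * Scalar inequalities for the logarithm and the exponential *)

Lemma ln_le_subr1 (R : realType) (x : R) : 0 < x -> ln x <= x - 1.
Proof.
by move=> x0; rewrite lerBrDl -[leRHS]lnK ?posrE // expR_ge1Dx.
Qed.

(** Termwise Gibbs inequality; summed over a row of two kernels, the left side cancels. *)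
Lemma subr_le_mul_ln (R : realType) (p q : R) : 0 < p -> 0 < q ->
  p - q <= p * ln (p / q).
Proof.
move=> p0 q0; have qp0 : 0 < q / p by exact: divr_gt0.
have := ln_le_subr1 qp0; rewrite -invf_div lnV ?posrE ?divr_gt0 //.
rewrite lerNl -(ler_pM2l p0) opprB mulrBr mulr1 invf_div mulrCA divff ?mulr1 //.
exact: lt0r_neq0.
Qed.

Lemma mul_ln_eq (R : realType) (p q : R) : 0 < p -> 0 < q ->
  p * ln (p / q) = p - q -> p = q.
Proof.
move=> p0 q0; have qp0 : 0 < q / p by exact: divr_gt0.
have pN0 := lt0r_neq0 p0.
have [l0|lN0] := eqVneq (ln (q / p)) 0.
  move=> _; have := lnK qp0; rewrite l0 expR0 => qp1.
  by rewrite -[q](divfK pN0) -qp1 mul1r.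
have := expR_gt1Dx lN0; rewrite lnK ?posrE // => lt e.
exfalso; move: lt; rewrite -invf_div lnV ?posrE ?divr_gt0 //.
rewrite -(ltr_pM2l p0) mulrDr mulrN e invf_div mulrCA divff // !mulr1.
by rewrite opprB addrC subrK ltxx.
Qed.

(** From [expR s <= 1 / (1 - s)] and [(1 - s) (1 + s + 2 s^2) = 1 + s^2 (1 - 2 s) >= 1]. *)
Lemma expR_le_quadratic (R : realType) (s : R) :
  `|s| <= 2^-1 -> expR s <= 1 + s + 2 * s ^+ 2.
Proof.
rewrite ler_norml => /andP[s1 s2].
have s0 : 0 < 1 - s by lra.
have : 1 - s <= (expR s)^-1 by rewrite -expRN expR_ge1Dx.
rewrite -[leRHS]mul1r ler_pdivlMr ?expR_gt0 // => h.
rewrite -(ler_pM2l s0); apply: le_trans h _.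
rewrite -subr_ge0 [leRHS](_ : _ = s ^+ 2 * (1 - 2 * s)); last by ring.
by rewrite mulr_ge0 ?sqr_ge0 //; lra.
Qed.

Lemma powR_mul_expR (R : realType) (a b t : R) : 0 < a -> 0 < b ->
  a `^ (1 - t) * b `^ t = a * expR (t * ln (b / a)).
Proof.
move=> a0 b0; rewrite /powR !gt_eqF // -expRD -{2}[a]lnK ?posrE // -expRD.
by rewrite ln_div ?posrE //; congr expR; ring.
Qed.

(** * Divergence along e-geodesics and the Pythagorean inequality *)

Section Kernels.
Variables (R : realType) (n : nat).
Hypothesis n0 : (0 < n)%N.
Implicit Types (D : {set 'I_n * 'I_n}) (P Q : 'M[R]_n).

Lemma divergence_sum D P Q : kernels D P -> divergence D P Q =
  \sum_x \sum_y stationary P 0 x * P x y * ln (P x y / Q x y).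
Proof.
move=> KP; rewrite /divergence pair_bigA /= big_mkcond /=.
apply: eq_bigr => -[x y] _ /=; case: ifPn => // xy.
by rewrite (kernel_off KP xy) mulr0 mul0r.
Qed.

Lemma divergence_le0_eq D P Q : strongly_connected D ->
  kernels D P -> kernels D Q -> divergence D P Q <= 0 -> P = Q.
Proof.
move=> sD KP KQ; rewrite (divergence_sum _ KP) => le0.
have [p0 p1 _ _] := stationary_spec n0 sD KP.
(* The correction has zero row sums and makes every term nonnegative, so a nonpositive divergence
   forces each term to vanish. *)
pose r x y := P x y * ln (P x y / Q x y) - (P x y - Q x y).
have r0 x y : 0 <= r x y.
  rewrite /r subr_ge0; have [xy|xy] := boolP ((x, y) \in D).
    by apply: subr_le_mul_ln; rewrite (kernel_gt0 KP, kernel_gt0 KQ).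
  by rewrite (kernel_off KP xy) (kernel_off KQ xy) subrr mul0r.
have rS x : \sum_y r x y = \sum_y P x y * ln (P x y / Q x y).
  by rewrite !sumrB (kernel_sum1 KP) (kernel_sum1 KQ) subrr subr0.
have S0 : \sum_x stationary P 0 x * \sum_y r x y = 0.
  apply: le_anti; apply/andP; split.
    apply: le_trans le0; apply: ler_sum => x _; rewrite rS mulr_sumr.
    by under eq_bigr do rewrite mulrA.
  by apply: sumr_ge0 => x _; rewrite mulr_ge0 ?sumr_ge0 // ltW.
apply/matrixP => x y.
have [xy|xy] := boolP ((x, y) \in D); last first.
  by rewrite (kernel_off KP xy) (kernel_off KQ xy).
apply: mul_ln_eq; [exact: kernel_gt0 KP _ _ xy|exact: kernel_gt0 KQ _ _ xy|].
move/eqP: S0; rewrite psumr_eq0 => [/allP/(_ x)|z _]; last first.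
  by rewrite mulr_ge0 ?sumr_ge0 // ltW.
rewrite mem_index_enum mulf_eq0 gt_eqF //= => /(_ isT).
rewrite psumr_eq0 // => /allP/(_ y); rewrite mem_index_enum => /(_ isT).
by rewrite subr_eq0 => /eqP.
Qed.

(* Fredholm alternative: the left kernel of [1 - P] is spanned by the
   stationary distribution. *)
Lemma poisson_equation D P (g : 'I_n -> R) : strongly_connected D ->
  kernels D P -> exists w : 'I_n -> R, forall x,
  g x + \sum_y P x y * w y - w x = \sum_z stationary P 0 z * g z.
Proof.
move=> sD KP; have [_ p1 _ uniq] := stationary_spec n0 sD KP.
set c := \sum_z _; pose G : 'rV[R]_n := \row_x (g x - c).
have : (G <= 1%:M - P^T)%MS.
  (* Columns of the cokernel are invariant under [P], hence multiples of the stationary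
     distribution, and the centered [G] is orthogonal to it. *)
  rewrite submxE; set K := cokermx _; apply/eqP/rowP => k.
  have : K^T *m P = K^T.
    have := mulmx_coker (1%:M - P^T); rewrite -/K => /(congr1 trmx).
    rewrite trmx_mul linearB /= trmxK trmx1 trmx0 mulmxBr mulmx1 => /eqP.
    by rewrite subr_eq0 => /eqP.
  move=> /(congr1 (row k)); rewrite row_mul => /uniq[a rK].
  have Kk x : K x k = a * stationary P 0 x.
    by have := congr1 (fun M : 'rV_n => M 0 x) rK; rewrite !mxE.
  rewrite mxE; under eq_bigr do rewrite mxE Kk mulrCA mulrBl.
  rewrite -mulr_sumr sumrB -mulr_sumr p1 mulr1 mxE.
  rewrite [X in X - _](_ : _ = c) ?subrr ?mulr0 //.
  by apply: eq_bigr => x _; rewrite mulrC.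
move=> /submxP[w Gw]; exists (w 0) => x.
have := congr1 (fun M : 'rV_n => M 0 x) Gw.
rewrite mulmxBr mulmx1 !mxE => /eqP; rewrite subr_eq => /eqP ->.
under [X in _ - X + _ + _]eq_bigr do rewrite mxE mulrC.
by ring.
Qed.

(** The matrix inside [e_geodesic] before rescaling, named so that its Perron root can be
    estimated. *)
Definition geometric_mix D P Q t : 'M[R]_n :=
  \matrix_(x, y) (if (x, y) \in D then P x y `^ (1 - t) * Q x y `^ t else 0).

Lemma geometric_mixE D P Q t x y : kernels D P -> kernels D Q ->
  geometric_mix D P Q t x y = P x y * expR (t * ln (Q x y / P x y)).
Proof.
move=> KP KQ; rewrite mxE; case: ifPn => xy; last first.
  by rewrite (kernel_off KP xy) mul0r.
by rewrite powR_mul_expR // (kernel_gt0 KP, kernel_gt0 KQ).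
Qed.

Lemma perron_geometric_mix D P Q t (A := geometric_mix D P Q t) :
  strongly_connected D -> kernels D P -> kernels D Q ->
  [/\ forall i, 0 < perron_vector A i 0, 0 < perron_root A
    & A *m perron_vector A = perron_root A *: perron_vector A].
Proof.
move=> sD KP KQ; apply: (perron_spec n0 sD (kernel_out KP)) => x y.
  by rewrite geometric_mixE // mulr_ge0 ?expR_ge0 // (kernel_ge0 KP).
by move=> xy; rewrite geometric_mixE // mulr_gt0 ?expR_gt0 // (kernel_gt0 KP).
Qed.

(* The coboundary [ln (v x) - ln (v y)] has zero mean under the stationary
   edge measure of P, so only the Perron root survives. *)
Lemma divergence_geodesic D D' P P0 P1 t : D \subset D' ->
  strongly_connected D -> strongly_connected D' ->
  kernels D P -> kernels D' P0 -> kernels D' P1 ->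
  divergence D P (e_geodesic D' P0 P1 t) =
  (1 - t) * divergence D P P0 + t * divergence D P P1 +
  ln (perron_root (geometric_mix D' P0 P1 t)).
Proof.
move=> DD' sD sD' KP K0 K1.
have [v0 r0 _] := perron_geometric_mix t sD' K0 K1.
have [p0 p1 pP _] := stationary_spec n0 sD KP.
have pPy y : \sum_x stationary P 0 x * P x y = stationary P 0 y.
  by have := congr1 (fun M : 'rV_n => M 0 y) pP; rewrite mxE.
rewrite !(divergence_sum _ KP) /e_geodesic -/(geometric_mix D' P0 P1 t).
set A := geometric_mix _ _ _ _ in v0 r0 *; set rho := perron_root A in r0 *.
set v := perron_vector A in v0 *; set p := stationary P in p0 p1 pP pPy *.
transitivity (\sum_x \sum_y (
    ((1 - t) * (p 0 x * P x y * ln (P x y / P0 x y)) +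
     t * (p 0 x * P x y * ln (P x y / P1 x y))) +
    (p 0 x * P x y * ln rho +
     (p 0 x * P x y * ln (v x 0) - p 0 x * P x y * ln (v y 0))))).
  apply: eq_bigr => x _; apply: eq_bigr => y _.
  have [xy|xy] := boolP ((x, y) \in D); last first.
    by rewrite (kernel_off KP xy) !(mulr0, mul0r) subrr !addr0.
  have xy' := fintype.subsetP DD' _ xy.
  have Pxy := kernel_gt0 KP xy.
  have P0xy := kernel_gt0 K0 xy'; have P1xy := kernel_gt0 K1 xy'.
  rewrite mxE -/A -/rho -/v /A geometric_mixE //.
  have lnD (a b : R) : 0 < a -> 0 < b -> ln (a / b) = ln a - ln b.
    by move=> a0 b0; rewrite ln_div.
  have lnM' (a b : R) : 0 < a -> 0 < b -> ln (a * b) = ln a + ln b.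
    by move=> a0 b0; rewrite lnM.
  have e0 := expR_gt0 (t * ln (P1 x y / P0 x y)).
  have e1 := mulr_gt0 P0xy e0; have e2 := mulr_gt0 e1 (v0 y).
  have e3 := mulr_gt0 r0 (v0 x); have e4 := divr_gt0 e2 e3.
  rewrite (lnD _ _ Pxy e4) (lnD _ _ e2 e3) (lnM' _ _ e1 (v0 y)).
  rewrite (lnM' _ _ P0xy e0) (lnM' _ _ r0 (v0 x)) expRK.
  by rewrite (lnD _ _ P1xy P0xy) (lnD _ _ Pxy P0xy) (lnD _ _ Pxy P1xy); ring.
under eq_bigr do rewrite !big_split /= -!mulr_sumr sumrN.
rewrite !big_split /= -!mulr_sumr sumrN.
(* Summing over x first turns the [ln (v y 0)] term into a stationary mean, which cancels the
   [ln (v x 0)] term. *)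
rewrite [X in _ + (_ + (_ - X))]exchange_big /=.
under [X in _ + (X + _)]eq_bigr do
  rewrite -mulr_suml -mulr_sumr (kernel_sum1 KP) mulr1.
under [X in _ + (_ + (X - _))]eq_bigr do
  rewrite -mulr_suml -mulr_sumr (kernel_sum1 KP) mulr1.
under [X in _ + (_ + (_ - X))]eq_bigr do rewrite -mulr_suml pPy.
by rewrite subrr addr0 -mulr_suml p1 mul1r.
Qed.

(* Collatz-Wielandt with the test vector [exp (t w)], where w solves the
   Poisson equation for the mean log-ratio; this avoids differentiating the
   Perron root at t = 0. *)
Lemma ln_perron_root_le D P Q : strongly_connected D ->
  kernels D P -> kernels D Q ->
  exists M delta : R, [/\ 0 < M, 0 < delta & forall t, 0 < t <= delta ->
    ln (perron_root (geometric_mix D P Q t)) <=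
    - t * divergence D P Q + t ^+ 2 * M].
Proof.
move=> sD KP KQ.
have [w wE] := poisson_equation (fun x => \sum_y P x y * ln (Q x y / P x y)) sD KP.
have dE : \sum_z stationary P 0 z * (\sum_y P z y * ln (Q z y / P z y)) =
    - divergence D P Q.
  rewrite (divergence_sum _ KP) -sumrN; apply: eq_bigr => x _.
  rewrite mulr_sumr -sumrN; apply: eq_bigr => y _.
  have [xy|xy] := boolP ((x, y) \in D); last first.
    by rewrite (kernel_off KP xy) !(mulr0, mul0r) oppr0.
  by rewrite -invf_div lnV ?posrE ?divr_gt0 ?(kernel_gt0 KP) ?(kernel_gt0 KQ) //; ring.
rewrite dE in wE; set d := divergence D P Q in wE *.
(* The coboundary of [w] makes the mean of [h] equal to [- d] in every row, not only on stationary
   average. *)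
pose h x y := ln (Q x y / P x y) + w y - w x.
have hE x : \sum_y P x y * h x y = - d.
  rewrite -(wE x); under eq_bigr do rewrite mulrBr mulrDr.
  by rewrite sumrB big_split /= -mulr_suml (kernel_sum1 KP) mul1r.
have hw x y s : s * ln (Q x y / P x y) + s * w y = s * w x + s * h x y.
  by rewrite /h; ring.
clearbody h; pose H := 1 + \sum_x \sum_y `|h x y|.
have hH x y : `|h x y| <= H.
  rewrite /H (bigD1 x) //= (bigD1 y) //= addrCA -addrA lerDl.
  rewrite !addr_ge0 ?sumr_ge0 // => i _; exact: sumr_ge0.
have H0 : 0 < H by rewrite ltr_pwDl // sumr_ge0 // => i _; exact: sumr_ge0.
(* For [t <= (2 H)^-1] one has [|t h| <= 1/2], the range of the quadratic bound on [expR], whose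
   remainder is at most [2 (t H)^2]. *)
clearbody H; exists (2 * H ^+ 2), (2 * H)^-1; split.
- by rewrite mulr_gt0 // exprn_gt0.
- by rewrite invr_gt0 mulr_gt0.
move=> t /andP[t0 tH].
have [v0 r0 Av] := perron_geometric_mix t sD KP KQ.
set A := geometric_mix D P Q t in v0 r0 Av *.
apply: le_trans (ln_le_subr1 r0) _; rewrite lerBlDl.
have A0 x y : 0 <= A x y.
  by rewrite geometric_mixE // mulr_ge0 ?expR_ge0 // (kernel_ge0 KP).
apply: le_trans (ler_norm _) _.
apply: (eigenvalue_norm_le (u := fun x => expR (t * w x)) A0).
- by move=> i; exact: expR_gt0.
- move=> x; rewrite mulrC.
  apply: (@le_trans _ _ (expR (t * w x) *
      \sum_y P x y * (1 + t * h x y + 2 * (t * H) ^+ 2))).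
    rewrite mulr_sumr; apply: ler_sum => y _.
    rewrite geometric_mixE // -mulrA -expRD mulrCA ler_wpM2l ?(kernel_ge0 KP) //.
    rewrite hw expRD ler_wpM2l ?expR_ge0 //.
    have thH : `|t * h x y| <= t * H by rewrite normrM gtr0_norm // ler_pM2l.
    apply: le_trans (expR_le_quadratic _) _.
      apply: le_trans thH _; rewrite -ler_pdivlMr // -invfM //.
    rewrite lerD2l ler_pM2l // -real_normK ?num_real //.
    by rewrite lerXn2r // nnegrE // mulr_ge0 // ltW.
  rewrite ler_wpM2l ?expR_ge0 //.
  under eq_bigr do rewrite !mulrDr mulr1 [P _ _ * (t * _)]mulrCA.
  rewrite !big_split /= -mulr_sumr hE -mulr_suml (kernel_sum1 KP) mul1r.
  by rewrite le_eqVlt; apply/orP; left; apply/eqP; ring.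
- exact: eigenvalue_right (positive_neq0 n0 v0) Av.
Qed.

Lemma argmin_pythagoras D D' P (C : set 'M[R]_n) P0 P1 : D \subset D' ->
  strongly_connected D -> strongly_connected D' ->
  kernels D P -> C `<=` kernels D' -> e_convex D' C ->
  argmin_divergence D C P P0 -> C P1 ->
  divergence D P P0 + divergence D' P0 P1 <= divergence D P P1.
Proof.
move=> DD' sD sD' KP CK Cconv [C0 min0] C1.
have [K0 K1] := (CK _ C0, CK _ C1).
have [M [delta [M0 delta0 rho_le]]] := ln_perron_root_le sD' K0 K1.
set a := divergence D P P0; set b := divergence D P P1.
set d := divergence D' P0 P1 in rho_le *.
rewrite leNgt; apply/negP => lt_b.
pose eps := a + d - b; have eps0 : 0 < eps by rewrite subr_gt0.
(* If the inequality fails by [eps], the divergence at [t] is at most [a - t eps + t^2 M]. The last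
   cap gives [t M <= eps / 2], which puts this below the minimum [a]. *)
pose t := Num.min (Num.min delta 1) (eps / (2 * M)).
have t0 : 0 < t by rewrite !lt_min delta0 ltr01 divr_gt0 ?mulr_gt0.
have t_delta : t <= delta by rewrite !ge_min lexx.
have t1 : t <= 1 by rewrite !ge_min lexx orbT.
have tM : t * (2 * M) <= eps.
  by rewrite -ler_pdivlMr ?mulr_gt0 // !ge_min lexx !orbT.
have := min0 _ (Cconv _ _ C0 C1 t _); rewrite (ltW t0) t1 => /(_ isT).
rewrite (divergence_geodesic t DD' sD sD' KP K0 K1) -/a -/b.
have := rho_le t; rewrite t0 t_delta => /(_ isT) r_le a_le.
have : 0 <= t * (t * M - eps) by rewrite /eps; lra.
rewrite pmulr_rge0 // subr_ge0.
by lra.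
Qed.

End Kernels.

(** * Existence of a minimizer by compactness *)

(* A bound on the divergence keeps every entry on D away from 0, so the
   sublevel sets of the divergence are relatively compact in [kernels_between]. *)
Lemma kernel_ge_of_divergence_le (R : realType) n (D D' : {set 'I_n * 'I_n})
    (P : 'M[R]_n) (c : R) : (0 < n)%N -> strongly_connected D ->
  D \subset D' -> kernels D P ->
  exists delta : 'I_n * 'I_n -> R, (forall e, 0 < delta e) /\
  forall Q, kernels D' Q -> divergence D P Q <= c ->
  forall e, e \in D -> delta e <= Q e.1 e.2.
Proof.
move=> n0 sD DD' KP; have [p0 _ _ _] := stationary_spec n0 sD KP.
pose a (e : 'I_n * 'I_n) := stationary P 0 e.1 * P e.1 e.2.
have a0 e : e \in D -> 0 < a e.
  by case: e => x y xy; rewrite mulr_gt0 ?(kernel_gt0 KP).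
(* Since [Q <= 1], all terms [- a f ln Q f] are nonnegative, so each single one is at most [b]. *)
pose b := c - \sum_(e in D) a e * ln (P e.1 e.2).
exists (fun e => expR (- (b / a e))); split=> [e|Q KQ le_c e eD].
  exact: expR_gt0.
have Q0 f : f \in D -> 0 < Q f.1 f.2.
  by case: f => x y /(fintype.subsetP DD') xy; exact: kernel_gt0 KQ _ _ xy.
have Q1 f : Q f.1 f.2 <= 1.
  rewrite -(kernel_sum1 KQ f.1) (bigD1 f.2) //= lerDl.
  by apply: sumr_ge0 => y _; exact: kernel_ge0 KQ _ _.
rewrite -[leRHS]lnK ?posrE ?Q0 // ler_expR lerNl ler_pdivlMr ?a0 // /b.
rewrite lerBrDl; apply: le_trans le_c; rewrite /divergence.
have -> : \sum_(f in D) stationary P 0 f.1 * P f.1 f.2 *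
      ln (P f.1 f.2 / Q f.1 f.2) =
    \sum_(f in D) a f * ln (P f.1 f.2) + \sum_(f in D) a f * - ln (Q f.1 f.2).
  rewrite -big_split /=; apply: eq_bigr => -[x y] xy.
  by rewrite ln_div ?posrE ?(kernel_gt0 KP) ?Q0 // -mulrDr.
rewrite lerD2l (bigD1 e) //= mulrC lerDl; apply: sumr_ge0 => f /andP[fD _].
by rewrite mulr_ge0 ?(ltW (a0 _ _)) // oppr_ge0 ln_le0.
Qed.

(** Relative closedness gives a closed [V] that agrees with [C] on [kernels_between D D']. The
    compact [K] lies in that space, so [K] meets [V] inside [C], and the intersection contains the
    sublevel set of [Q0]. *)
Lemma argmin_divergence_exists (R : realType) n (D D' : {set 'I_n * 'I_n})
    (P : 'M[R]_n) (C : set 'M[R]_n) : (0 < n)%N -> strongly_connected D ->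
  D \subset D' -> kernels D P -> C `<=` kernels D' -> C !=set0 ->
  closed (C : set (subspace (kernels_between D D'))) ->
  exists Q, argmin_divergence D C P Q.
Proof.
move=> n0 sD DD' KP CK [Q0 CQ0] /closed_subspaceP[V Vcl VC].
have [delta [delta0 deltaP]] :=
  kernel_ge_of_divergence_le (divergence D P Q0) n0 sD DD' KP.
pose cube := [set Q : 'M[R]_n | forall i j, 0 <= Q i j <= 1].
pose rows := [set Q : 'M[R]_n | forall x, \sum_y Q x y = 1].
(* Together with [cube] this forces the entries off [D'] to be 0. *)
pose off := [set Q : 'M[R]_n | forall e, e \notin D' -> Q e.1 e.2 <= 0].
pose on := [set Q : 'M[R]_n | forall e, e \in D -> delta e <= Q e.1 e.2].
pose K := cube `&` (rows `&` off `&` on).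
have cQ i j : continuous (fun Q : 'M[R]_n => Q i j) by exact: coord_continuous.
have cS i : continuous (fun Q : 'M[R]_n => \sum_j Q i j).
  exact: continuous_sumr.
have cc (c : R) : continuous (fun _ : 'M[R]_n => c).
  exact: cst_continuous.
have clK : closed (rows `&` off `&` on).
  apply: closedI; first apply: closedI.
  - rewrite (_ : rows = \bigcap_x ([set Q : 'M[R]_n | \sum_y Q x y <= 1] `&`
        [set Q : 'M[R]_n | 1 <= \sum_y Q x y])).
      apply: closed_bigI => x _; apply: closedI; exact: closed_le_continuous.
    apply/seteqP; split=> Q /= Qx x; first by move=> _; rewrite /= Qx.
    by have [/= le1 ge1] := Qx x I; apply: le_anti; rewrite le1.
  - rewrite (_ : off = \bigcap_(e in [set e | e \notin D'])
        [set Q : 'M[R]_n | Q e.1 e.2 <= 0]) //.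
    by apply: closed_bigI => e _; exact: closed_le_continuous.
  - rewrite (_ : on = \bigcap_(e in [set e | e \in D])
        [set Q : 'M[R]_n | delta e <= Q e.1 e.2]) //.
    by apply: closed_bigI => e _; exact: closed_le_continuous.
have cKV : compact (K `&` V).
  apply: compact_closedI Vcl; apply: compact_closedI clK.
  exact: compact_unit_cube.
have K_between : K `<=` kernels_between D D'.
  move=> Q [Q01 [[Qrow Qoff] Qon]].
  (* The intermediate edge set is the support of [Q]; limits may lose edges outside [D], but none in
     [D]. *)
  exists [set e : 'I_n * 'I_n | 0 < Q e.1 e.2]%SET; split.
  - apply/fintype.subsetP => e eD; rewrite inE.
    exact: lt_le_trans (delta0 e) (Qon e eD).
  - apply/fintype.subsetP => e; rewrite inE; apply: contraTT => /Qoff.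
    by rewrite -leNgt.
  - split=> //; split=> x y; rewrite inE //= => Qxy.
    by apply: le_anti; rewrite leNgt Qxy /=; have /andP[] := Q01 x y.
have KV_C Q : (K `&` V) Q -> C Q.
  move=> [/K_between KQ VQ].
  by have : (V `&` kernels_between D D') Q by []; rewrite VC => -[].
have C_KV Q : C Q -> divergence D P Q <= divergence D P Q0 -> (K `&` V) Q.
  move=> CQ le; have KQ := CK _ CQ; split; last first.
    have : (C `&` kernels_between D D') Q.
      by split=> //; exists D'; split.
    by rewrite -VC => -[].
  split.
    move=> x y; rewrite (kernel_ge0 KQ) /= -(kernel_sum1 KQ x) (bigD1 y) //=.
    by rewrite lerDl sumr_ge0 // => z _; exact: kernel_ge0 KQ _ _.
  split; last exact: deltaP.
  split; first by move=> x; exact: kernel_sum1 KQ x.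
  by move=> [x y] xy /=; rewrite (kernel_off KQ xy).
have cdiv : {within K `&` V, continuous (divergence D P)}.
  apply: continuous_in_subspaceT => Q /set_mem[[_ [_ Qon]] _].
  pose f e (M : 'M[R]_n) :=
    stationary P 0 e.1 * P e.1 e.2 * ln (P e.1 e.2 / M e.1 e.2).
  apply: (@cvg_sumr R _ (nbhs Q) _ _ (fun e => e \in D) f (f^~ Q)) => e eD.
  have Qe : 0 < Q e.1 e.2 := lt_le_trans (delta0 e) (Qon e eD).
  have Pe : 0 < P e.1 e.2 by case: e eD {Qe} => x y; exact: kernel_gt0 KP _ _.
  apply: cvgM; first exact: cvg_cst.
  have cr : P e.1 e.2 / M e.1 e.2 @[M --> nbhs Q] --> P e.1 e.2 / Q e.1 e.2.
    apply: cvgM; first exact: cvg_cst.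
    by apply: cvgV; [exact: lt0r_neq0 | exact: cQ].
  apply: (cvg_comp _ _ cr).
  by apply: continuous_ln; exact: divr_gt0.
have KV0 : (K `&` V) !=set0 by exists Q0; exact: C_KV.
have [Q /set_mem KVQ Qmin] := compact_EVT_min KV0 cKV cdiv.
exists Q; split=> [|Pbar CPbar]; first exact: KV_C.
(* Outside the sublevel set the competitor is already worse than [Q0], which belongs to the compact
   set. *)
have [le|lt] := leP (divergence D P Pbar) (divergence D P Q0).
  by apply: Qmin; apply/mem_set; exact: C_KV.
by apply: le_trans (ltW lt); apply: Qmin; apply/mem_set; exact: C_KV.
Qed.

(** * Unique reverse projection and its Pythagorean characterization *)

Theorem proposition5p2 (R : realType) (n : nat) (hn : (1 < n)%N)
    (D D' : {set 'I_n * 'I_n})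
    (hD : strongly_connected D) (hD' : strongly_connected D')
    (hDD' : D \subset D')
    (P : 'M[R]_n) (hP : kernels D P)
    (C : set 'M[R]_n) (hC : C `<=` kernels D') (hC0 : C !=set0)
    (hCclosed : closed (C : set (subspace (kernels_between D D'))))
    (hCconvex : e_convex D' C) :
  (exists! Q : 'M[R]_n, argmin_divergence D C P Q) /\
  (forall P0 : 'M[R]_n, C P0 ->
     ((forall Pbar : 'M[R]_n, C Pbar ->
         divergence D P Pbar >= divergence D P P0 + divergence D' P0 Pbar) <->
      P0 = reverse_projection D C P)).
Proof.
have n0 : (0 < n)%N := ltnW hn.
have pyth P0 P1 : argmin_divergence D C P P0 -> C P1 ->
    divergence D P P0 + divergence D' P0 P1 <= divergence D P P1.
  exact: (argmin_pythagoras n0 hDD' hD hD' hP hC hCconvex).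
have [Q argQ] := argmin_divergence_exists n0 hD hDD' hP hC hC0 hCclosed.
have uniq Q' : argmin_divergence D C P Q' -> Q = Q'.
  move=> argQ'; have [[CQ _] [CQ' minQ']] := (argQ, argQ').
  apply: (divergence_le0_eq n0 hD' (hC _ CQ) (hC _ CQ')).
  (* The Pythagorean inequality at [Q] and minimality of [Q'] leave no room for a positive
     divergence from [Q] to [Q']. *)
  rewrite -(lerD2l (divergence D P Q)) addr0.
  exact: le_trans (pyth _ _ argQ CQ') (minQ' _ CQ).
split; first by exists Q.
have projE : reverse_projection D C P = Q.
  by apply: xget_unique => // Q' /uniq.
move=> P0 CP0; rewrite projE; split=> [ineq|-> Pbar CPbar]; last exact: pyth.
apply/esym/uniq; split=> // Pbar CPbar.
(* In the negative case the equality case of Gibbs' inequality identifies [P0] with [Pbar]. *)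
have [ge0|le0] := leP 0 (divergence D' P0 Pbar).
  by apply: le_trans (ineq _ CPbar); rewrite lerDl.
by rewrite (divergence_le0_eq n0 hD' (hC _ CP0) (hC _ CPbar) (ltW le0)).
Qed.
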